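(* Let $a \in C^1(\mathbb{R})$ be strictly convex and increasing with $a(0)=0$, let $F(v)=\int_0^v a(\xi)\,d\xi$, and let $$K_a = \left\{\begin{bmatrix} a(v) & u\\ u & v\\ a(v)u & \frac{1}{2}u^2 + F(v)\end{bmatrix} : u,v \in \mathbb{R}\right\} \subset \mathbb{R}^{3\times 2}.$$ Then $K_a$ does not contain $T_5$ configurations, i.e. there is no ordered set of five distinct matrices $X_1,\dots,X_5 \in K_a$ that induces a $T_5$ configuration.
   Context: An ordered set of $N$ distinct matrices $\{X_1,\dots,X_N\} \subset \mathbb{R}^{m\times n}$ is said to induce a $T_N$ configuration if there exist matrices $Q, D_1,\dots,D_N \in \mathbb{R}^{m\times n}$ and real numbers $k_1,\dots,k_N>1$ such that (i) $\operatorname{rank}(D_i)\le 1$ for each $i$; (ii) $\sum_{i=1}^N D_i = 0$; (iii) $X_i = Q + \sum_{j=1}^{i-1} D_j + k_i D_i$ for all $1\le i\le N$. *)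

(* Defs.v *)
From HB Require Import structures.
From mathcomp Require Import all_boot all_order all_algebra.
From mathcomp Require Import all_classical all_reals all_analysis.

Set Implicit Arguments.
Unset Strict Implicit.
Unset Printing Implicit Defensive.

Import Order.TTheory GRing.Theory Num.Theory.
Import numFieldNormedType.Exports.

Local Open Scope classical_set_scope.
Local Open Scope ring_scope.

Definition C1 (R : realType) (f : R -> R) : Prop :=
  (forall x, derivable f x 1) /\ continuous (derive1 f).

Definition strictly_convex (R : realType) (f : R -> R) : Prop :=
  forall x y t : R, x != y -> 0 < t < 1 ->
    f (t * x + (1 - t) * y) < t * f x + (1 - t) * f y.

Definition strictly_increasing (R : realType) (f : R -> R) : Prop :=
  forall x y : R, x < y -> f x < f y.

(* The library only integrates over sets; this is the oriented integral, with
   the usual sign convention when y < x. *)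
Definition oriented_integral (R : realType) (f : R -> R) (x y : R) : R :=
  if x <= y then \int[lebesgue_measure]_(t in `[x, y]) f t
  else - \int[lebesgue_measure]_(t in `[y, x]) f t.

(* The condition (iii) is X_i = Q + D_1 + ... + D_{i-1} + k_i D_i, with indices
   shifted to start at 0. *)
Definition induces_TN (R : realType) (m n N : nat)
    (X : 'I_N -> 'M[R]_(m, n)) : Prop :=
  injective X /\
  exists (Q : 'M[R]_(m, n)) (D : 'I_N -> 'M[R]_(m, n)) (k : 'I_N -> R),
    [/\ forall i, 1 < k i,
        forall i, (\rank (D i) <= 1)%N,
        \sum_(i < N) D i = 0 &
        forall i, X i = Q + \sum_(j < N | (j < i)%N) D j + k i *: D i].

Definition Ka_mx (R : realType) (a : R -> R) (u v : R) : 'M[R]_(3, 2) :=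
  \matrix_(i < 3, j < 2)
    nth 0 (nth [::] [:: [:: a v ; u];
                        [:: u ; v];
                        [:: a v * u ; 2^-1 * u ^+ 2 + oriented_integral a 0 v]]
             i) j.

Definition Ka (R : realType) (a : R -> R) : set 'M[R]_(3, 2) :=
  [set M | exists u v : R, M = Ka_mx a u v].

(* Main.v *)
Require Import Defs.
From HB Require Import structures.
From mathcomp Require Import all_boot all_order all_algebra.
From mathcomp Require Import all_classical all_reals all_analysis.
From mathcomp Require Import ring lra.

(* A point (u, v) stands for the matrix X of K_a with these parameters. Every
   2x2 minor is affine along rank-one segments, so that going once around the
   cycle of a T_N configuration yields, for each i, positive weights w_j with
   sum_j w_j M(X_i - X_j) = 0 for each of the three minors M. Write
     e_pq = 2 (F(v_p) - F(v_q) - a(v_q) (v_p - v_q)) >= 0,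
     h_pq = e_pq - (u_p - u_q)^2   ([ent]),
     m_pq = (h_pq + h_qp) / 2      ([mdet], the minor of the first two rows).
   Up to linear combinations with constants depending on i only, the three
   minors are m_ij, (a_i - a_j) h_ji and (u_i - u_j) h_ij; [comb] is their
   general combination. A contradiction arises as soon as some combination is
   nonnegative at all j and positive at one of them.

   The relation m_pq >= 0 says that the symmetric matrix formed by the first two
   rows of X_p - X_q is semidefinite, so it is a partial order once the points
   are sorted by v. The first two minors force, for each i, the a_j with
   m_ij >= 0 not to lie all below those with m_ij < 0. Twelve orders on five
   points pass this test, in three families. Each of them has two maximal
   elements, the top point 5 and another point k. Convexity of a gives
   triangle inequalities for the square roots of e_pq and of (a_p - a_q) (v_p -
   v_q), which place the points not below k (or 5) on one side of it in u. A line
   A = kappa x + c in the plane of x = u_j - u_i, A = a_i - a_j then separates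
   the points below i from the others, and the corresponding combination in
   row i has a constant sign. *)

Set Implicit Arguments.
Unset Strict Implicit.
Unset Printing Implicit Defensive.

Import Order.TTheory GRing.Theory Num.Theory.
Import numFieldNormedType.Exports.

(* [B i j] stands for 0 <= mdet p_i p_j, where p_0, ..., p_4 are sorted by v. *)
Definition compatible (B : nat -> nat -> bool) : bool :=
  all (fun i => all (fun t =>
    ~~ all (fun q => (q == i) || (if B i q then q <= t else t <= q)) (iota 0 5))
    (iota 0 5)) (iota 0 5) &&
  all (fun i => all (fun j => all (fun k =>
    [&& i < j, j < k, B i j & B j k] ==> B i k)
    (iota 0 5)) (iota 0 5)) (iota 0 5).

(** Exhaustion over the ten values [B i j] with i < j. Indices 0 to 4 stand for p1 to p5, and the
    three alternatives are the families 15-35-24, 23-45-15 and 14-25-34, named after the pairs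
    required to be comparable. *)
Lemma compatible_cases (B : nat -> nat -> bool) :
  (forall i j, B i j = B j i) -> compatible B ->
  [|| [&& B 0 4, B 2 4, B 1 3, ~~ B 0 1, ~~ B 0 3, ~~ B 1 2, ~~ B 1 4, ~~ B 3 4
        & ~~ B 0 2 || ~~ B 2 3],
      [&& B 1 2, B 3 4, B 0 4, ~~ B 0 1, ~~ B 0 2, ~~ B 2 3 & ~~ B 2 4] |
      [&& B 0 3, B 1 4, B 2 3, ~~ B 0 1, ~~ B 0 4, ~~ B 1 2, ~~ B 1 3, ~~ B 3 4
        & ~~ B 0 2 || ~~ B 2 4]].
Proof.
move=> BC; rewrite /compatible /= (BC 1 0) (BC 2 0) (BC 3 0) (BC 4 0) (BC 2 1).
rewrite (BC 3 1) (BC 4 1) (BC 3 2) (BC 4 2) (BC 4 3).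
move: (B 0 1) (B 0 2) (B 0 3) (B 0 4) (B 1 2) (B 1 3) (B 1 4) (B 2 3) (B 2 4).
by move: (B 3 4); do 10!case.
Qed.

Local Open Scope classical_set_scope.
Local Open Scope ring_scope.

(** * Finite configurations of five points *)

Section Core.
Variables (R : realFieldType) (a F : R -> R).
Hypothesis a_incr : forall x y, x < y -> a x < a y.
Hypothesis a_chord : forall x y z, x <= y -> y <= z ->
  (a y - a x) * (z - y) <= (a z - a y) * (y - x).
Hypothesis F_trap : forall x y, x < y ->
  2 * (F y - F x) < (a x + a y) * (y - x).
Hypothesis F_above : forall x y, x <= y -> a x * (y - x) <= F y - F x.
Hypothesis F_right : forall x y z, x < y -> y <= z ->
  (a y - a x) * (z - y) ^+ 2 <= 2 * (F z - F y - a y * (z - y)) * (y - x).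
Hypothesis F_left : forall x y z, x <= y -> y < z ->
  2 * (a y * (y - x) - (F y - F x)) * (z - y) <= (a z - a y) * (y - x) ^+ 2.

(** * Entropies, determinants and the sign of their combinations *)

Definition ent (p q : R * R) : R :=
  2 * (F p.2 - F q.2 - a q.2 * (p.2 - q.2)) - (p.1 - q.1) ^+ 2.
Definition mdet (p q : R * R) : R :=
  (a p.2 - a q.2) * (p.2 - q.2) - (p.1 - q.1) ^+ 2.
Definition comb (l k c : R) (p q : R * R) : R :=
  l * (a p.2 - a q.2) * ent q p - k * (q.1 - p.1) * ent p q - c * mdet p q.

Implicit Types p q r : R * R.

Ltac order_only := repeat match goal with
  | H : context [mdet] |- _ => clear H
  | H : context [ent] |- _ => clear H
  end.
Ltac olra := order_only; lra.
Ltac onra := order_only; nra.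

Lemma le_or_lt (x y : R) : x <= y \/ y < x.
Proof. by case: (leP x y); [left | right]. Qed.

Lemma mdet_sym p q : mdet p q = mdet q p.
Proof. by rewrite /mdet; ring. Qed.

Lemma mdet_refl p : mdet p p = 0.
Proof. by rewrite /mdet; ring. Qed.

Lemma ent_addE p q : ent p q + ent q p = 2 * mdet p q.
Proof. by rewrite /ent /mdet; ring. Qed.

Lemma a_le x y : x <= y -> a x <= a y.
Proof. by rewrite le_eqVlt => /orP[/eqP->//|/a_incr/ltW]. Qed.

Lemma a_sub_ge0 x y : x <= y -> 0 <= a y - a x.
Proof. by move=> /a_le; rewrite subr_ge0. Qed.

Lemma a_sub_gt0 x y : x < y -> 0 < a y - a x.
Proof. by move=> /a_incr; rewrite subr_gt0. Qed.

(** The difference [mdet p q - ent p q] is the error of the trapezoidal rule for F between the two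
    points. *)
Lemma ent_lt p q : q.2 < p.2 -> ent p q < mdet p q /\ mdet p q < ent q p.
Proof. by move=> /F_trap; rewrite /ent /mdet => H; split; nra. Qed.

Lemma ent_le p q : q.2 <= p.2 -> ent p q <= mdet p q /\ mdet p q <= ent q p.
Proof.
rewrite le_eqVlt => /orP[/eqP e|/ent_lt[/ltW ? /ltW ?]//].
by rewrite /ent /mdet e; split; nra.
Qed.

Lemma mdet_lt0_eq p q : p != q -> q.2 = p.2 -> mdet p q < 0.
Proof.
case: p q => [u v] [u' v'] /= + e; rewrite {}e xpair_eqE eqxx andbT => ne.
have : 0 < (u - u') ^+ 2 by rewrite exprn_even_gt0 //= subr_eq0.
by rewrite /mdet /=; lra.
Qed.

(* In terms of y = k (u_q - u_p) and A = a_p - a_q, the value of [comb] is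
   mdet (l A - y - c) + d (l A + y), where d = (ent q p - ent p q) / 2
   has the sign of v_p - v_q. *)
Lemma comb_below_le p q l k c : q.2 <= p.2 -> mdet p q <= 0 -> 0 <= l ->
  0 <= k * (q.1 - p.1) ->
  l * (a p.2 - a q.2) <= k * (q.1 - p.1) + c -> 0 <= comb l k c p q.
Proof.
move=> vqp mN l0 y0 le; have [h1 h2] := ent_le vqp; have hE := ent_addE p q.
have A0 : 0 <= l * (a p.2 - a q.2) by rewrite mulr_ge0 // subr_ge0 a_le.
rewrite /comb; set y := k * _ in y0 le *; set A := l * _ in A0 le *.
have -> : ent q p = 2 * mdet p q - ent p q by lra.
have : 0 <= (mdet p q - ent p q) * (A + y) by apply: mulr_ge0; lra.
have : 0 <= - mdet p q * (y + c - A) by apply: mulr_ge0; lra.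
lra.
Qed.

Lemma comb_below_lt p q l k c : q.2 < p.2 -> mdet p q <= 0 -> 0 <= l ->
  0 <= k * (q.1 - p.1) -> 0 < l * (a p.2 - a q.2) + k * (q.1 - p.1) ->
  l * (a p.2 - a q.2) <= k * (q.1 - p.1) + c -> 0 < comb l k c p q.
Proof.
move=> vqp mN l0 y0 Ay le; have [h1 h2] := ent_lt vqp; have hE := ent_addE p q.
rewrite /comb; set y := k * _ in y0 Ay le *; set A := l * _ in Ay le *.
have -> : ent q p = 2 * mdet p q - ent p q by lra.
have : 0 < (mdet p q - ent p q) * (A + y) by apply: mulr_gt0; lra.
have : 0 <= - mdet p q * (y + c - A) by apply: mulr_ge0; lra.
lra.
Qed.

Lemma comb_below_ge p q l k c : q.2 <= p.2 -> 0 <= mdet p q ->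
  - (k * (q.1 - p.1)) <= l * (a p.2 - a q.2) ->
  c <= l * (a p.2 - a q.2) - k * (q.1 - p.1) -> 0 <= comb l k c p q.
Proof.
move=> vqp mP Ay le; have [h1 h2] := ent_le vqp; have hE := ent_addE p q.
rewrite /comb; set y := k * _ in Ay le *; set A := l * _ in Ay le *.
have -> : ent q p = 2 * mdet p q - ent p q by lra.
have : 0 <= (mdet p q - ent p q) * (A + y) by apply: mulr_ge0; lra.
have : 0 <= mdet p q * (A - y - c) by apply: mulr_ge0; lra.
lra.
Qed.

(** Here the value is split as mdet (2 l A - c) - ent p q (l A + y). For [ent p q <= 0] this relaxes
    the upper bound on c from l A - y to 2 l A. *)
Lemma comb_below_mid p q l k c : q.2 <= p.2 -> 0 <= mdet p q -> ent p q <= 0 ->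
  0 <= l -> 0 <= k * (q.1 - p.1) -> c <= 2 * l * (a p.2 - a q.2) ->
  0 <= comb l k c p q.
Proof.
move=> vqp mP hN l0 y0 le; have hE := ent_addE p q.
have A0 : 0 <= l * (a p.2 - a q.2) by rewrite mulr_ge0 // subr_ge0 a_le.
rewrite /comb; have -> : ent q p = 2 * mdet p q - ent p q by lra.
move: le; rewrite -mulrA; set y := k * _ in y0 *; set A := l * _ in A0 * => le.
have : 0 <= - ent p q * (A + y) by apply: mulr_ge0; lra.
have : 0 <= mdet p q * (2 * A - c) by apply: mulr_ge0; lra.
lra.
Qed.

(** For q above p, [ent q p <= mdet p q <= 0], and each of the three terms of [comb] is nonnegative
    on its own. *)
Lemma comb_above p q l k c : p.2 <= q.2 -> mdet p q <= 0 -> ent p q <= 0 ->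
  0 <= l -> 0 <= k * (q.1 - p.1) -> 0 <= c -> 0 <= comb l k c p q.
Proof.
move=> vpq mN hN l0 y0 c0; have [h1 h2] := ent_le vpq; rewrite mdet_sym in h1 h2.
have A0 : 0 <= l * (a q.2 - a p.2) by rewrite mulr_ge0 // subr_ge0 a_le.
have : 0 <= - ent p q * (k * (q.1 - p.1)) by apply: mulr_ge0; lra.
have : 0 <= (- ent q p) * (l * (a q.2 - a p.2)) by apply: mulr_ge0; lra.
have : 0 <= c * - mdet p q by apply: mulr_ge0; lra.
rewrite /comb; lra.
Qed.

Lemma comb_above_lt p q l k c : p.2 <= q.2 -> mdet p q <= 0 -> ent p q < 0 ->
  0 <= l -> 0 < k * (q.1 - p.1) -> 0 <= c -> 0 < comb l k c p q.
Proof.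
move=> vpq mN hN l0 y0 c0; have [h1 h2] := ent_le vpq; rewrite mdet_sym in h1 h2.
have A0 : 0 <= l * (a q.2 - a p.2) by rewrite mulr_ge0 // subr_ge0 a_le.
have : 0 < - ent p q * (k * (q.1 - p.1)) by apply: mulr_gt0; lra.
have : 0 <= (- ent q p) * (l * (a q.2 - a p.2)) by apply: mulr_ge0; lra.
have : 0 <= c * - mdet p q by apply: mulr_ge0; lra.
rewrite /comb; lra.
Qed.

Lemma comb_below_norm p q l k : q.2 <= p.2 -> 0 <= mdet p q ->
  `|k * (q.1 - p.1)| <= l * (a p.2 - a q.2) -> 0 <= comb l k 0 p q.
Proof. by rewrite ler_norml => v m0 /andP[? ?]; apply: comb_below_ge => //; lra. Qed.

Lemma ent_lt0 p q : q.2 <= p.2 -> mdet p q < 0 -> ent p q < 0.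
Proof. by move=> /ent_le[? _]; lra. Qed.

Lemma F_trap_le x y : x <= y -> 2 * (F y - F x) <= (a x + a y) * (y - x).
Proof.
by rewrite le_eqVlt => /orP[/eqP->|/F_trap/ltW//]; rewrite !subrr !mulr0.
Qed.

(* The three lemmas below are triangle inequalities along the cylinder: the
   square roots of the quantities compared with (u_p - u_q)^2 in [mdet] and [ent]
   are super- or subadditive along increasing v. *)
Lemma ent_between x y z : x.2 <= y.2 -> y.2 <= z.2 -> mdet x y <= 0 ->
  mdet y z <= 0 ->
  0 <= (y.1 - x.1) * (z.1 - y.1) -> ent z x <= 0.
Proof.
move=> vxy vyz; rewrite /mdet /ent => m1 m2 pq0.
have t1 := F_trap_le vxy; have t2 := F_trap_le vyz.
have c := a_chord vxy vyz.
have [A1 A2] : 0 <= a y.2 - a x.2 /\ 0 <= a z.2 - a y.2.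
  by rewrite !subr_ge0 !a_le.
set X := a x.2 in m1 t1 c A1 *; set Y := a y.2 in m1 m2 t1 t2 c A1 A2.
set Z := a z.2 in m2 t2 c A2.
set l1 := y.2 - x.2 in m1 t1 c; set l2 := z.2 - y.2 in m2 t2 c.
have l10 : 0 <= l1 by rewrite subr_ge0. have l20 : 0 <= l2 by rewrite subr_ge0.
set p := y.1 - x.1 in pq0; set q := z.1 - y.1 in pq0.
have -> : z.1 - x.1 = p + q by rewrite /p /q; ring.
have -> : z.2 - x.2 = l1 + l2 by rewrite /l1 /l2; ring.
have m1' : (Y - X) * l1 <= p ^+ 2 by rewrite /p /l1; nra.
have m2' : (Z - Y) * l2 <= q ^+ 2 by rewrite /q /l2; nra.
(* Squares are compared: [m1'] and [m2'] bound (p q)^2 below by (Y - X) l1 (Z - Y) l2, and the chord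
   inequality bounds this below by ((Y - X) l2)^2. *)
have : (Y - X) * l2 <= p * q.
  rewrite -(@ler_pXn2r _ 2) ?nnegrE ?(mulr_ge0 A1 l20) //.
  have : ((Y - X) * l1) * ((Z - Y) * l2) <= p ^+ 2 * q ^+ 2.
    by apply: ler_pM => //; rewrite mulr_ge0.
  have : (Y - X) * l2 * ((Y - X) * l2) <= (Y - X) * l2 * ((Z - Y) * l1).
    by rewrite ler_wpM2l // mulr_ge0.
  lra.
lra.
Qed.

Lemma ent_between_inc x y z : x.2 <= y.2 -> y.2 <= z.2 -> mdet x y < 0 ->
  mdet y z < 0 ->
  x.1 <= y.1 -> y.1 <= z.1 -> ent z x <= 0.
Proof.
move=> vxy vyz /ltW mxy /ltW myz uxy uyz; apply: ent_between mxy myz _ => //.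
by apply: mulr_ge0; lra.
Qed.

Lemma ent_between_dec x y z : x.2 <= y.2 -> y.2 <= z.2 -> mdet x y < 0 ->
  mdet y z < 0 ->
  z.1 <= y.1 -> y.1 <= x.1 -> ent z x <= 0.
Proof.
move=> vxy vyz /ltW mxy /ltW myz uxy uyz; apply: ent_between mxy myz _ => //.
by apply: mulr_le0; lra.
Qed.

Lemma ent_ge0_left x y z : x.2 <= y.2 -> y.2 <= z.2 -> 0 <= mdet x y ->
  0 <= ent y z ->
  0 <= ent x z.
Proof.
move=> vxy vyz; rewrite /mdet /ent => m1 h2.
have t1 := F_trap_le vxy.
have fr : (a y.2 - a x.2) * (z.2 - y.2) ^+ 2
    <= 2 * (F z.2 - F y.2 - a y.2 * (z.2 - y.2)) * (y.2 - x.2).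
  move: vxy; rewrite le_eqVlt => /orP[/eqP->|/F_right]; last exact.
  by rewrite !subrr mul0r mulr0.
have [A1 A2] : 0 <= a y.2 - a x.2 /\ 0 <= a z.2 - a y.2.
  by rewrite !subr_ge0 !a_le.
have l10 : 0 <= y.2 - x.2 by rewrite subr_ge0.
have l20 : 0 <= z.2 - y.2 by rewrite subr_ge0.
set X := a x.2 in m1 t1 fr A1 *; set Y := a y.2 in m1 fr t1 A1 A2 *.
set Z := a z.2 in h2 A2 *.
set l1 := y.2 - x.2 in m1 t1 fr l10; set l2 := z.2 - y.2 in fr l20.
set p := y.1 - x.1; set q := z.1 - y.1.
set e := 2 * (F y.2 - F z.2 - Z * (y.2 - z.2)) in h2.
have eE : e = 2 * (Z * l2 - (F z.2 - F y.2)) by rewrite /e /l2; ring.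
have m1' : p ^+ 2 <= (Y - X) * l1 by rewrite /p /l1; nra.
have h2' : q ^+ 2 <= e by rewrite /q; nra.
have : p * q <= (Z - Y) * l1.
  apply: le_trans (ler_norm _) _.
  rewrite -(@ler_pXn2r _ 2) ?nnegrE ?mulr_ge0 // -normrX ger0_norm ?sqr_ge0 //.
  have : p ^+ 2 * q ^+ 2 <= (Y - X) * l1 * e by apply: ler_pM; rewrite ?sqr_ge0.
  (* [F_right] bounds e from above. With S = (Y - X) l2 and T = (Z - Y) l1 this yields (p q)^2 <= 2
     S T - S^2 <= T^2. *)
  have : (Y - X) * (l1 * e) <= (Y - X) * (2 * (Z - Y) * l1 * l2 - (Y - X) * l2 ^+ 2).
    by rewrite ler_wpM2l // eE; lra.
  have : 0 <= ((Z - Y) * l1 - (Y - X) * l2) ^+ 2 by rewrite sqr_ge0.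
  lra.
have -> : x.1 - z.1 = - (p + q) by rewrite /p /q; ring.
have -> : x.2 - z.2 = - (l1 + l2) by rewrite /l1 /l2; ring.
lra.
Qed.

Lemma ent_ge0_right x y z : x.2 <= y.2 -> y.2 <= z.2 -> 0 <= ent x y ->
  0 <= mdet y z ->
  0 <= ent x z.
Proof.
move=> vxy vyz; rewrite /mdet /ent => h1 m2.
have t2 := F_trap_le vyz.
have fl : 2 * (a y.2 * (y.2 - x.2) - (F y.2 - F x.2)) * (z.2 - y.2)
    <= (a z.2 - a y.2) * (y.2 - x.2) ^+ 2.
  move: vyz; rewrite le_eqVlt => /orP[/eqP<-|/(F_left vxy)]; last exact.
  by rewrite !subrr mul0r mulr0.
have [A1 A2] : 0 <= a y.2 - a x.2 /\ 0 <= a z.2 - a y.2.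
  by rewrite !subr_ge0 !a_le.
have l10 : 0 <= y.2 - x.2 by rewrite subr_ge0.
have l20 : 0 <= z.2 - y.2 by rewrite subr_ge0.
set X := a x.2 in A1 *; set Y := a y.2 in h1 m2 fl t2 A1 A2 *.
set Z := a z.2 in m2 fl t2 A2 *.
set l1 := y.2 - x.2 in fl l10; set l2 := z.2 - y.2 in fl l20 t2.
set p := y.1 - x.1; set q := z.1 - y.1.
set e := 2 * (F x.2 - F y.2 - Y * (x.2 - y.2)) in h1.
have eE : e = 2 * (Y * l1 - (F y.2 - F x.2)) by rewrite /e /l1; ring.
have m2' : q ^+ 2 <= (Z - Y) * l2 by rewrite /q /l2; nra.
have h1' : p ^+ 2 <= e by rewrite /p; nra.
have : p * q <= (Z - Y) * l1.
  apply: le_trans (ler_norm _) _.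
  rewrite -(@ler_pXn2r _ 2) ?nnegrE ?mulr_ge0 // -normrX ger0_norm ?sqr_ge0 //.
  have : p ^+ 2 * q ^+ 2 <= e * ((Z - Y) * l2) by apply: ler_pM; rewrite ?sqr_ge0.
  have : (Z - Y) * (e * l2) <= (Z - Y) * ((Z - Y) * l1 ^+ 2).
    by rewrite ler_wpM2l // eE; lra.
  lra.
have -> : x.1 - z.1 = - (p + q) by rewrite /p /q; ring.
have -> : x.2 - z.2 = - (l1 + l2) by rewrite /l1 /l2; ring.
lra.
Qed.

(** * Comparison of positions and slopes *)

Lemma ent_mono x y z : x.2 <= y.2 -> y.2 <= z.2 ->
  (z.1 - x.1) ^+ 2 <= (y.1 - x.1) ^+ 2 -> ent y x <= ent z x.
Proof.
move=> vxy vyz; rewrite /ent => le; have f := F_above vyz; have := a_le vxy.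
rewrite -subr_ge0 => A0.
have : 0 <= (a y.2 - a x.2) * (z.2 - y.2) by rewrite mulr_ge0 // subr_ge0.
lra.
Qed.

(** The product (a_q - a_p) (v_q - v_p) grows as the interval of v widens. With a common endpoint,
    the resulting inequality decides on which side in u a point lies. *)
Lemma sqr_lt_nested p q p' q' : p'.2 <= p.2 -> p.2 <= q.2 -> q.2 <= q'.2 ->
  0 <= mdet p q -> mdet p' q' < 0 -> (q.1 - p.1) ^+ 2 < (q'.1 - p'.1) ^+ 2.
Proof.
move=> v1 v2 v3; rewrite /mdet => m1 m2.
have : (a q.2 - a p.2) * (q.2 - p.2) <= (a q'.2 - a p'.2) * (q'.2 - p'.2).
  have := a_le v1; have := a_le v2; have := a_le v3 => *.
  by apply: ler_pM; lra.
lra.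
Qed.

(** By convexity (v_i - v) / (a_i - a(v)) decreases in v. It bounds x^2 / A^2 from above at p and
    from below at j, in the plane of row i. *)
Lemma cone_slope i p j : j.2 <= p.2 -> p.2 <= i.2 -> 0 <= mdet i p ->
  mdet i j <= 0 ->
  `|p.1 - i.1| * (a i.2 - a j.2) <= (a i.2 - a p.2) * `|j.1 - i.1|.
Proof.
move=> vjp vpi; rewrite /mdet => mp mj.
have c := a_chord vjp vpi.
have [A1 A2] : 0 <= a p.2 - a j.2 /\ 0 <= a i.2 - a p.2.
  by rewrite !subr_ge0 !a_le.
have A3 : 0 <= a i.2 - a j.2 by lra.
rewrite -(@ler_pXn2r _ 2) ?nnegrE ?mulr_ge0 // !exprMn -!normrX.
rewrite !(ger0_norm (sqr_ge0 _)).
set A := a i.2 - a j.2 in mj A3 *; set B := a i.2 - a p.2 in mp A2 *.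
have h1 : (p.1 - i.1) ^+ 2 * A ^+ 2 <= B * (i.2 - p.2) * A ^+ 2.
  by rewrite ler_wpM2r ?sqr_ge0 //; lra.
have h2 : B ^+ 2 * (A * (i.2 - j.2)) <= B ^+ 2 * (j.1 - i.1) ^+ 2.
  by rewrite ler_wpM2l ?sqr_ge0 //; lra.
have : 0 <= A * B * (B * (p.2 - j.2) - (a p.2 - a j.2) * (i.2 - p.2)).
  by rewrite mulr_ge0 ?mulr_ge0 // subr_ge0.
rewrite (_ : a p.2 - a j.2 = A - B) ; last by rewrite /A /B; ring.
lra.
Qed.

(** All that the finite argument retains of the positive weights: a weighted sum of nonnegative
    values can be zero only if all the values are. *)
Definition balanced (s : seq (R * R)) : Prop :=
  forall p, p \in s -> forall l k c, {in s, forall q, 0 <= comb l k c p q} ->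
  {in s, forall q, comb l k c p q = 0}.

(** For l = 2, k = 0 and c = 2 (a_p - t), the combination is 2 (t - a_q) mdet + (a_p - a_q) (ent q p
    - ent p q), a sum of two nonnegative terms, so both vanish. *)
Lemma threshold_absurd s p t : balanced s -> uniq s -> (1 < size s)%N -> p \in s ->
  {in s, forall q, q != p ->
    (0 <= mdet p q -> a q.2 <= t) /\ (mdet p q < 0 -> t <= a q.2)} -> False.
Proof.
move=> bs us ss ps H.
have d0 q : 0 <= (a p.2 - a q.2) * (ent q p - ent p q).
  case/orP: (le_total p.2 q.2) => v; have [] := ent_le v; have := a_le v => *.
    by rewrite mulr_le0 //; lra.
  by rewrite mulr_ge0 //; lra.
have combE q : comb 2 0 (2 * (a p.2 - t)) p q
    = 2 * (t - a q.2) * mdet p q + (a p.2 - a q.2) * (ent q p - ent p q).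
  have := ent_addE p q; rewrite /comb => e.
  have -> : ent p q = 2 * mdet p q - ent q p by lra.
  ring.
have tm q : q \in s -> 0 <= 2 * (t - a q.2) * mdet p q.
  move=> qs; have [->|qp] := eqVneq q p.
    by rewrite mdet_refl mulr0.
  have [H1 H2] := H q qs qp.
  case: (leP 0 (mdet p q)) => mpq; first by rewrite mulr_ge0 //; have := H1 mpq; lra.
  by rewrite mulr_le0 ?(ltW mpq) //; have := H2 mpq; lra.
have comb0 : {in s, forall q, comb 2 0 (2 * (a p.2 - t)) p q = 0}.
  by apply: bs => // q qs; rewrite combE addr_ge0 // tm.
(* By strictness in [ent_lt], the second term vanishes only when v_q = v_p. *)
have veq q : q \in s -> q.2 = p.2.
  move=> qs; have := comb0 q qs; rewrite combE => e.
  have e0 : (a p.2 - a q.2) * (ent q p - ent p q) = 0.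
    by have := tm q qs; have := d0 q; lra.
  case: (ltgtP q.2 p.2) => // v; have := a_incr v; have [] := ent_lt v.
    move=> h1 h2 h3; suff : 0 < (a p.2 - a q.2) * (ent q p - ent p q) by lra.
    by rewrite mulr_gt0 //; lra.
  move=> h1 h2 h3; suff : 0 < (a q.2 - a p.2) * (ent p q - ent q p) by lra.
  by rewrite mulr_gt0 //; lra.
have mlt q : q \in s -> q != p -> mdet p q < 0.
  by move=> qs qp; apply: mdet_lt0_eq (veq q qs); rewrite eq_sym.
have [q qs qp] : exists2 q, q \in s & q != p.
  case: s us ss ps {bs H comb0 tm veq mlt} => [|x [|y s]] //= /andP[+ _] _ _.
  rewrite inE negb_or => /andP[xy _].
  have [xp|] := eqVneq x p; last by exists x; rewrite ?mem_head.
  by exists y; rewrite ?inE ?eqxx ?orbT // -xp eq_sym.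
(* With all v equal, -mdet is itself a combination of constant sign, positive away from p. *)
have comb1 q' : comb 0 0 1 p q' = - mdet p q' by rewrite /comb; ring.
have : comb 0 0 1 p q = 0.
  apply: bs => // q' qs'; rewrite comb1; have [->|/(mlt _ qs')] := eqVneq q' p.
    by rewrite mdet_refl oppr0.
  by lra.
by rewrite comb1; have := mlt q qs qp; lra.
Qed.

Lemma balanced_perm s s' : perm_eq s s' -> balanced s -> balanced s'.
Proof.
move=> ss bs p ps l k c H q qs; apply: (bs p) => //.
- by rewrite (perm_mem ss).
- by move=> r rs; apply: H; rewrite -(perm_mem ss).
- by rewrite (perm_mem ss).
Qed.

(** The reflection of u preserves [ent] and [mdet] and changes k into -k. It allows each family to
    be treated under a single order in u of its two maximal points. *)
Definition flip p : R * R := (- p.1, p.2).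

Lemma ent_flip p q : ent (flip p) (flip q) = ent p q.
Proof. by rewrite /ent /=; ring. Qed.

Lemma mdet_flip p q : mdet (flip p) (flip q) = mdet p q.
Proof. by rewrite /mdet /=; ring. Qed.

Lemma comb_flip l k c p q : comb l k c (flip p) (flip q) = comb l (- k) c p q.
Proof. by rewrite /comb !ent_flip mdet_flip /=; ring. Qed.

Lemma balanced_flip s : balanced s -> balanced (map flip s).
Proof.
move=> bs _ /mapP[p ps ->] l k c H _ /mapP[q qs ->]; rewrite comb_flip.
by apply: bs => // r rs; rewrite -comb_flip; apply: H; rewrite map_f.
Qed.

(** The argument of [cone_slope] with consecutive increments instead of a common vertex. It supplies
    the slope comparison between points 1, 3 and 4 that [separating_line] assumes. *)
Lemma cone_slope_step x y z : x.2 <= y.2 -> y.2 <= z.2 -> mdet x y <= 0 ->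
  0 <= mdet y z ->
  `|z.1 - y.1| * (a y.2 - a x.2) <= (a z.2 - a y.2) * `|y.1 - x.1|.
Proof.
move=> vxy vyz; rewrite /mdet => m1 m2; have c := a_chord vxy vyz.
have [A1 A2] := (a_sub_ge0 vxy, a_sub_ge0 vyz).
rewrite -(@ler_pXn2r _ 2) ?nnegrE ?mulr_ge0 // !exprMn -!normrX.
rewrite !(ger0_norm (sqr_ge0 _)).
set A := a y.2 - a x.2 in A1 c *; set B := a z.2 - a y.2 in A2 c *.
have h1 : (z.1 - y.1) ^+ 2 * A ^+ 2 <= B * (z.2 - y.2) * A ^+ 2.
  by rewrite ler_wpM2r ?sqr_ge0 // /B; lra.
have h2 : B ^+ 2 * (A * (y.2 - x.2)) <= B ^+ 2 * (y.1 - x.1) ^+ 2.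
  by rewrite ler_wpM2l ?sqr_ge0 // /A; lra.
have : 0 <= A * B * (B * (y.2 - x.2) - A * (z.2 - y.2)).
  by rewrite mulr_ge0 ?mulr_ge0 // subr_ge0.
lra.
Qed.

(* The line A = (k x + c) / l is to separate the points (x1, A1) and (x4, A4)
   from (x2, A2) and (x3, A3). *)
Lemma separating_line (x1 x2 x3 x4 A1 A2 A3 A4 h2 h3 : R) :
  0 < x1 -> 0 < x4 -> 0 <= A4 -> A4 < A3 -> A3 <= A2 ->
  `|x2| * A1 <= A2 * x1 -> `|x3| * A1 <= A3 * x1 ->
  (0 < x2 -> 0 < h2 -> x2 < x4) ->
  (0 < x3 -> x4 < x3 -> (x3 - x4) * (A1 - A3) <= (A3 - A4) * (x1 - x3)) ->
  (0 < x2 -> h2 <= 0 -> 0 < x3 -> h3 <= 0 -> False) ->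
  exists l k c, [/\ [/\ 0 <= l, 0 < k & 0 <= c],
    l * A1 <= k * x1 + c, l * A4 <= k * x4 + c,
    (- (k * x2) <= l * A2 /\ c <= l * A2 - k * x2) \/
      [/\ h2 <= 0, 0 <= x2 & c <= 2 * l * A2] &
    (- (k * x3) <= l * A3 /\ c <= l * A3 - k * x3) \/
      [/\ h3 <= 0, 0 <= x3 & c <= 2 * l * A3]].
Proof.
move=> x1p x4p A4p A43 A32 anc2 anc3 g2 far n23.
(* A point j in {2, 3} with h_j <= 0 and x_j >= 0 only requires c <= 2 l A_j. The slope is the
   smallest ratio A_j / |x_j| over the points that still constrain it, and c lifts the line over
   point 4 where needed. *)
have [x3n|x3p] := le_or_lt x3 0.
  rewrite (ler0_norm x3n) in anc3.
  have [x2n|x2p] := le_or_lt x2 0.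
    rewrite (ler0_norm x2n) in anc2.
    have [le|/ltW le] := le_or_lt (A3 * - x2) (A2 * - x3).
      by exists (- x3), A3, (- x3 * A4); split; [split| | |left; split|left; split]; nra.
    by exists (- x2), A2, (- x2 * A4); split; [split| | |left; split|left; split]; nra.
  have [h2n|h2p] := le_or_lt h2 0.
    exists (- x3), A3, (- x3 * A4).
    by split; [split| | |right; split|left; split]; nra.
  have {}g2 := g2 x2p h2p; rewrite (gtr0_norm x2p) in anc2.
  have [le|/ltW le] := le_or_lt (A3 * x2) (A2 * - x3); last first.
    by exists x2, A2, 0; split; [split| | |left; split|left; split]; nra.
  have [c0|/ltW c0] := le_or_lt (- x3 * A4) (A3 * x4).
    by exists (- x3), A3, 0; split; [split| | |left; split|left; split]; nra.
  exists (- x3), A3, (- x3 * A4 - A3 * x4).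
  by split; [split| | |left; split|left; split]; nra.
rewrite (gtr0_norm x3p) in anc3.
have [h3n|h3p] := le_or_lt h3 0.
  have [x2n|x2p] := le_or_lt x2 0.
    rewrite (ler0_norm x2n) in anc2.
    exists (- x2), A2, (- x2 * A4).
    by split; [split| | |left; split|right; split]; nra.
  have [h2n|h2p] := le_or_lt h2 0; first by case: n23.
  have {}g2 := g2 x2p h2p; rewrite (gtr0_norm x2p) in anc2.
  by exists x2, A2, 0; split; [split| | |left; split|right; split]; nra.
have base : exists l k c, [/\ [/\ 0 < l, 0 < k & 0 <= c],
    l * A1 <= k * x1 + c, l * A4 <= k * x4 + c, l * A3 = k * x3 + c &
    k * x2 <= l * A2 -> (0 < x2 -> x2 < x4) -> 0 < x2 -> c <= l * A2 - k * x2].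
  have [le|lt] := le_or_lt (A4 * x3) (A3 * x4).
    by exists x3, A3, 0; split; [split| | | |]; nra.
  have x43 : x4 < x3 by nra.
  exists (x3 - x4), (A3 - A4), (A4 * x3 - A3 * x4).
  split; [split; lra | | | |]; first by have := far x3p x43; lra.
  - by lra.
  - by ring.
  - by move=> _ x24 /x24 {}x24; nra.
have [l [k [c [[l0 k0 c0] n1 n4 e3 e2]]]] := base; clear base far n23 anc3.
have lA : l * A3 <= l * A2 by rewrite ler_pM2l.
have kx3 := mulr_gt0 k0 x3p; have k0' := ltW k0; have l0' := ltW l0.
have kx3A : k * x3 <= l * A3 by lra.
have p3 : - (k * x3) <= l * A3 /\ c <= l * A3 - k * x3 by split; lra.
have [x2n|x2p] := le_or_lt x2 0.
  rewrite (ler0_norm x2n) in anc2; have x2n' : 0 <= - x2 by rewrite oppr_ge0.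
  have kx2 := mulr_ge0 k0' x2n'.
  have [le|lt] := le_or_lt (k * - x2) (l * A2).
    by exists l, k, c; split; [split| | |left; split; lra |left].
  (* The base line is too steep for point 2. It is replaced by a line of slope A2 / |x2|, through
     the origin or through point 4; [kk] and [kk2] keep point 3 above it. *)
  have lt' : 0 <= k * - x2 - l * A2 by lra.
  have kk : A2 * x3 <= - x2 * A3.
    rewrite -(ler_pM2l l0).
    have := mulr_ge0 lt' (ltW x3p); have kA : 0 <= l * A3 - k * x3 by lra.
    by have := mulr_ge0 x2n' kA; lra.
  have kk2 : A2 * (x3 - x4) <= - x2 * (A3 - A4).
    have kx : 0 <= l * (A3 - A4) - k * (x3 - x4) by lra.
    have [x34|x43] := le_or_lt x3 x4; first by clear n1 n4 e3 e2 p3 anc2 g2; nra.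
    rewrite -(ler_pM2l l0); have x43' : 0 <= x3 - x4 by lra.
    by have := mulr_ge0 lt' x43'; have := mulr_ge0 x2n' kx; lra.
  clear l k c l0 k0 c0 n1 n4 e3 e2 lA kx3 k0' l0' kx3A p3 kx2 lt lt'.
  have [c1|/ltW c1] := le_or_lt (- x2 * A4) (A2 * x4).
    by exists (- x2), A2, 0; split; [split| | |left; split|left; split]; nra.
  exists (- x2), A2, (- x2 * A4 - A2 * x4).
  by split; [split| | |left; split|left; split]; nra.
have [h2n|h2p] := le_or_lt h2 0.
  by exists l, k, c; split; [split| | |right; split; lra |left].
have {}g2 := g2 x2p h2p; rewrite (gtr0_norm x2p) in anc2.
have kx2 := mulr_gt0 k0 x2p.
have [le|/ltW lt] := le_or_lt (k * x2) (l * A2).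
  by exists l, k, c; split; [split| | |left; split; [lra | exact: e2] |left].
have kk : A2 * x3 <= x2 * A3.
  have lt' : 0 <= k * x2 - l * A2 by lra.
  rewrite -(ler_pM2l l0); have := mulr_ge0 lt' (ltW x3p).
  have kA : 0 <= l * A3 - k * x3 by lra.
  by have := mulr_ge0 (ltW x2p) kA; lra.
clear l k c l0 k0 c0 n1 n4 e3 e2 lA kx3 k0' l0' kx3A p3 kx2 lt.
by exists x2, A2, 0; split; [split| | |left; split|left; split]; nra.
Qed.

Lemma comb_refl l k c p : comb l k c p p = 0.
Proof. by rewrite /comb mdet_refl !subrr; ring. Qed.

Lemma comb_aE p q : comb 1 0 0 p q = (a p.2 - a q.2) * ent q p.
Proof. by rewrite /comb; ring. Qed.

Lemma comb_uE k p q : comb 0 k 0 p q = - (k * (q.1 - p.1)) * ent p q.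
Proof. by rewrite /comb; ring. Qed.

Lemma mdet_ge0_lt p q : q != p -> q.2 <= p.2 -> 0 <= mdet p q -> q.2 < p.2.
Proof.
move=> qp; rewrite le_eqVlt => /orP[/eqP e|//].
by move=> m0; have := mdet_lt0_eq (_ : p != q) e; rewrite eq_sym => /(_ qp); lra.
Qed.

(** * The three families on five points sorted by v *)

Section Five.
Variables p1 p2 p3 p4 p5 : R * R.
Let s := [:: p1; p2; p3; p4; p5].
Hypothesis us : uniq s.
Hypothesis bs : balanced s.
Hypotheses (v12 : p1.2 <= p2.2) (v23 : p2.2 <= p3.2).
Hypotheses (v34 : p3.2 <= p4.2) (v45 : p4.2 <= p5.2).

Let v13 : p1.2 <= p3.2. Proof. exact: le_trans v23. Qed.
Let v24 : p2.2 <= p4.2. Proof. exact: le_trans v34. Qed.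
Let v35 : p3.2 <= p5.2. Proof. exact: le_trans v45. Qed.
Let v14 : p1.2 <= p4.2. Proof. exact: le_trans v34. Qed.
Let v25 : p2.2 <= p5.2. Proof. exact: le_trans v45. Qed.
Let v15 : p1.2 <= p5.2. Proof. exact: le_trans v45. Qed.

Lemma row_absurd p q l k c : p \in s -> q \in s ->
  0 <= comb l k c p p1 -> 0 <= comb l k c p p2 -> 0 <= comb l k c p p3 ->
  0 <= comb l k c p p4 -> 0 <= comb l k c p p5 -> 0 < comb l k c p q -> False.
Proof.
move=> ps qs s1 s2 s3 s4 s5; rewrite (bs ps _ qs) ?ltxx // => r.
by rewrite !inE => /orP[/eqP->|/orP[/eqP->|/orP[/eqP->|/orP[/eqP->|/eqP->]]]].
Qed.

Let s1 : p1 \in s. Proof. by rewrite !inE eqxx ?orbT. Qed.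
Let s2 : p2 \in s. Proof. by rewrite !inE eqxx ?orbT. Qed.
Let s3 : p3 \in s. Proof. by rewrite !inE eqxx ?orbT. Qed.
Let s4 : p4 \in s. Proof. by rewrite !inE eqxx ?orbT. Qed.
Let s5 : p5 \in s. Proof. by rewrite !inE eqxx ?orbT. Qed.

Let neqs : [&& p1 != p2, p1 != p3, p1 != p4, p1 != p5, p2 != p3, p2 != p4,
  p2 != p5, p3 != p4, p3 != p5 & p4 != p5].
Proof.
by move: us; rewrite /s /= !inE !negb_or andbT -!andbA.
Qed.

(** Row p5 with the values (a_5 - a_j) ent p_j p5, where the value at p1 is positive by [ent_lt].
    Its use is to force [ent] to be negative from the other maximal point to p5. *)
Lemma top_row_absurd : 0 <= mdet p1 p5 -> 0 <= ent p2 p5 ->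
  0 <= ent p3 p5 -> 0 <= ent p4 p5 ->
  False.
Proof.
move=> m15 h25 h35 h45; have /and5P[_ _ _ n15 _] := neqs.
have v15' : p1.2 < p5.2 by apply: mdet_ge0_lt; rewrite // mdet_sym.
have [_] := ent_lt v15'; rewrite mdet_sym => h15.
apply: (@row_absurd p5 p1 1 0 0) => //; rewrite comb_aE.
- by apply: mulr_ge0; [exact: a_sub_ge0 | lra].
- by apply: mulr_ge0 => //; apply: a_sub_ge0.
- by apply: mulr_ge0 => //; apply: a_sub_ge0.
- by apply: mulr_ge0 => //; apply: a_sub_ge0.
- by rewrite subrr mul0r.
- by apply: mulr_gt0; [exact: a_sub_gt0 | lra].
Qed.

(** Row p1 with the values (a_1 - a_j) ent p_j p1; it serves to locate p1 in u. *)
Lemma bottom_row_absurd q : q \in s -> p1.2 < q.2 -> ent q p1 < 0 ->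
  ent p2 p1 <= 0 ->
  ent p3 p1 <= 0 -> ent p4 p1 <= 0 -> ent p5 p1 <= 0 -> False.
Proof.
move=> qs vq hq h2 h3 h4 h5.
apply: (@row_absurd p1 q 1 0 0) => //; rewrite comb_aE.
- by rewrite subrr mul0r.
- by apply: mulr_le0 => //; have := a_le v12; lra.
- by apply: mulr_le0 => //; have := a_le v13; lra.
- by apply: mulr_le0 => //; have := a_le v14; lra.
- by apply: mulr_le0 => //; have := a_le v15; lra.
- by rewrite nmulr_rgt0 //; have := a_incr vq; lra.
Qed.

(** The maximal points are p3 and p5. In row p3 only p2 is below, and p1, p4, p5 turn out to lie to
    the left in u; the separating line is |x_2| A = A_2 |x|. *)
Lemma absurd_23_45_15 : 0 <= mdet p2 p3 -> 0 <= mdet p4 p5 -> 0 <= mdet p1 p5 ->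
  mdet p1 p2 < 0 ->
  mdet p1 p3 < 0 -> mdet p3 p4 < 0 -> mdet p3 p5 < 0 -> p5.1 < p3.1 -> False.
Proof.
move=> m23 m45 m15 m12 m13 m34 m35 u53.
have /and5P[_ _ _ _ /and5P[n23 _ _ _ _]] := neqs.
have v23' : p2.2 < p3.2 by apply: mdet_ge0_lt; rewrite // mdet_sym.
have h35 : ent p3 p5 < 0.
  rewrite ltNge; apply/negP => h35; apply: top_row_absurd => //.
    exact: ent_ge0_left m23 h35.
  by have [_] := ent_le v45; rewrite mdet_sym; lra.
have h34 : ent p3 p4 < 0.
  rewrite ltNge; apply/negP => h34.
  by have := ent_ge0_right v34 v45 h34 m45; lra.
have u43 : p4.1 < p3.1.
  rewrite ltNge; apply/negP => u34.
  by have := sqr_lt_nested v34 v45 (lexx _) m45 m35; onra.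
(* Otherwise u decreases from p1 through p3 to both p4 and p5, and row p1 has constant sign. *)
have u13 : p1.1 < p3.1.
  rewrite ltNge; apply/negP => u31.
  have h3 : ent p3 p1 < 0 by have [+ _] := ent_le v13; rewrite mdet_sym; lra.
  have h2 : ent p2 p1 <= 0 by have [+ _] := ent_le v12; rewrite mdet_sym; lra.
  apply: (@bottom_row_absurd p3) => //; [exact: le_lt_trans v23' | exact: ltW | |].
    by apply: (@ent_between_dec p1 p3 p4) => //; apply: ltW.
  by apply: (@ent_between_dec p1 p3 p5) => //; apply: ltW.
have A2 : 0 < a p3.2 - a p2.2 by rewrite subr_gt0 a_incr.
have := cone_slope v12 v23; rewrite ![mdet p3 _]mdet_sym => /(_ m23 (ltW m13)).
rewrite (ltr0_norm (_ : p1.1 - p3.1 < 0)) ?subr_lt0 // => anc.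
apply: (@row_absurd p3 p5 `|p2.1 - p3.1| (- (a p3.2 - a p2.2)) 0) => //.
- by apply: comb_below_le; rewrite // ?[mdet p3 _]mdet_sym ?(ltW m13) //; onra.
- rewrite comb_below_ge // ?[mdet p3 _]mdet_sym //.
    have := ler_norm (p2.1 - p3.1); nra.
  have := ler_norm (- (p2.1 - p3.1)); rewrite normrN; nra.
- by rewrite comb_refl.
- by apply: comb_above; rewrite // ?(ltW m34) ?(ltW h34) //; onra.
- by apply: comb_above; rewrite // ?(ltW m35) ?(ltW h35) //; onra.
- by apply: comb_above_lt; rewrite // ?(ltW m35) //; onra.
Qed.

(** The maximal points are p4 and p5. If p3 is below p4, row p4 with the flatter of the cone slopes
    of p2 and p3 suffices. Otherwise row p5 first places p3 to the left of p4 in u, and row p4 is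
    then split by the side of p2. *)
Lemma absurd_15_35_24 : 0 <= mdet p1 p5 -> 0 <= mdet p3 p5 -> 0 <= mdet p2 p4 ->
  mdet p1 p2 < 0 ->
  mdet p1 p4 < 0 -> mdet p2 p3 < 0 -> mdet p2 p5 < 0 -> mdet p4 p5 < 0 ->
  mdet p1 p3 < 0 \/ mdet p3 p4 < 0 -> p5.1 < p4.1 -> False.
Proof.
move=> m15 m35 m24 m12 m14 m23 m25 m45 m1334 u54.
have /and5P[_ _ _ _ /and5P[_ n24 _ n34 _]] := neqs.
have v24' : p2.2 < p4.2 by apply: mdet_ge0_lt; rewrite // mdet_sym.
have v14' : p1.2 < p4.2 by apply: le_lt_trans v24'.
have h45 : ent p4 p5 < 0.
  rewrite ltNge; apply/negP => h45; apply: top_row_absurd => //.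
    exact: ent_ge0_left m24 h45.
  by have [_] := ent_le v35; rewrite mdet_sym; lra.
have h41 : ent p4 p1 < 0 by apply: ent_lt0; rewrite // mdet_sym.
have h21 : ent p2 p1 <= 0 by apply/ltW/ent_lt0; rewrite // mdet_sym.
have A2 : 0 < a p4.2 - a p2.2 by apply: a_sub_gt0.
have anc2 := cone_slope v12 v24; rewrite ![mdet p4 _]mdet_sym in anc2.
have {}anc2 := anc2 m24 (ltW m14).
have [m34|m34] := le_or_lt 0 (mdet p3 p4).
  have m13 : mdet p1 p3 < 0 by case: m1334 => //; rewrite ltNge m34.
  have v34' : p3.2 < p4.2 by apply: mdet_ge0_lt; rewrite // mdet_sym.
  have A3 : 0 < a p4.2 - a p3.2 by apply: a_sub_gt0.
  have u14 : p1.1 < p4.1.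
    rewrite ltNge; apply/negP => u41; apply: (@bottom_row_absurd p4) => //.
    - by apply/ltW/ent_lt0; rewrite // mdet_sym.
    - exact: ltW.
    - by apply: (@ent_between_dec p1 p4 p5) => //; apply: ltW.
  have anc3 := cone_slope v13 v34; rewrite ![mdet p4 _]mdet_sym in anc3.
  have {}anc3 := anc3 m34 (ltW m14).
  rewrite (ltr0_norm (_ : p1.1 - p4.1 < 0)) ?subr_lt0 // in anc2 anc3.
  have row4 l k : 0 <= l -> 0 < k -> l * (a p4.2 - a p1.2) <= k * - (p1.1 - p4.1) ->
      k * `|p2.1 - p4.1| <= l * (a p4.2 - a p2.2) ->
      k * `|p3.1 - p4.1| <= l * (a p4.2 - a p3.2) -> False.
    move=> l0 k0 n1 n2 n3; apply: (@row_absurd p4 p5 l (- k) 0) => //.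
    - by apply: comb_below_le; rewrite // ?[mdet p4 _]mdet_sym ?(ltW m14) //; onra.
    - apply: comb_below_norm; rewrite // ?[mdet p4 _]mdet_sym //.
      by rewrite mulNr normrN normrM (gtr0_norm k0).
    - apply: comb_below_norm; rewrite // ?[mdet p4 _]mdet_sym //.
      by rewrite mulNr normrN normrM (gtr0_norm k0).
    - by rewrite comb_refl.
    - by apply: comb_above; rewrite // ?(ltW m45) ?(ltW h45) //; onra.
    - by apply: comb_above_lt; rewrite // ?(ltW m45) //; onra.
  have [le|/ltW le] := le_or_lt ((a p4.2 - a p2.2) * `|p3.1 - p4.1|)
                           ((a p4.2 - a p3.2) * `|p2.1 - p4.1|).
    by apply: (row4 `|p2.1 - p4.1| (a p4.2 - a p2.2)) => //; olra.
  by apply: (row4 `|p3.1 - p4.1| (a p4.2 - a p3.2)) => //; olra.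
have h31m : 0 < ent p3 p1 -> 0 <= mdet p1 p3.
  by have [+ _] := ent_le v13; rewrite [mdet p3 _]mdet_sym; lra.
have u34 : p3.1 < p4.1.
  rewrite ltNge; apply/negP => u43.
  have h53 : ent p5 p3 <= 0.
    by apply: (@ent_between_dec p3 p4 p5) => //; apply: ltW.
  have h54 : ent p5 p4 < 0 by apply: ent_lt0; rewrite // mdet_sym.
  have h52 : ent p5 p2 < 0 by apply: ent_lt0; rewrite // mdet_sym.
  have u52 : p5.1 < p2.1.
    rewrite ltNge; apply/negP => u25.
    by have := sqr_lt_nested (lexx _) v24 v45 m24 m25; onra.
  have uh1 : 0 < (p1.1 - p5.1) * ent p5 p1.
    rewrite ltNge; apply/negP => uh1; apply: (@row_absurd p5 p4 0 1 0) => //.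
    - by rewrite comb_uE mul1r mulNr oppr_ge0.
    - by rewrite comb_uE mul1r; apply: mulr_le0; lra.
    - by rewrite comb_uE mul1r; apply: mulr_le0; lra.
    - by rewrite comb_uE mul1r; apply: mulr_le0; lra.
    - by rewrite comb_refl.
    - by rewrite comb_uE mul1r nmulr_rgt0 // oppr_lt0 subr_gt0.
  have u51 : p5.1 < p1.1.
    rewrite ltNge; apply/negP => u15.
    have h51 : ent p5 p1 < 0 by nra.
    apply: (@bottom_row_absurd p4) => //; try exact: ltW.
    rewrite leNgt; apply/negP => h31.
    by have := @ent_mono p1 p3 p5 v13 v35; move=> /(_ _); nra.
  have h51 : 0 < ent p5 p1 by nra.
  have u12 : p1.1 < p2.1.
    rewrite ltNge; apply/negP => u21.
    suff : ent p5 p1 <= 0 by lra.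
    by apply: (@ent_between_dec p1 p2 p5) => //; apply: ltW.
  have a12 := a_sub_ge0 v12; have a23 := a_sub_ge0 v23.
  have a34 := a_sub_ge0 v34; have a35 := a_sub_ge0 v35.
  have v25' := lt_le_trans v24' v45; have a25 := a_sub_gt0 v25'.
  have [x1 x2] : 0 < p1.1 - p5.1 /\ 0 < p2.1 - p5.1 by rewrite !subr_gt0.
  have [x4 x12] : 0 < p4.1 - p5.1 /\ 0 < p2.1 - p1.1 by rewrite !subr_gt0.
  have x3 : 0 < p3.1 - p5.1 by rewrite subr_gt0 (lt_le_trans u54).
  have y1 := mulr_ge0 a23 (ltW x12); have y2 := mulr_ge0 (ltW x2) a12.
  have y3 := mulr_ge0 a23 (ltW x1); have y4 := mulr_ge0 a23 (ltW x2).
  have y5 := mulr_ge0 a23 (ltW x4); have y6 := mulr_ge0 a23 (ltW x3).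
  have y7 := mulr_ge0 (ltW x2) a34; have y8 := mulr_ge0 (ltW x2) a35.
  have y9 := mulr_gt0 x2 a25.
  (* The line through (0, a_5 - a_3) and (u_2 - u_5, a_5 - a_2); p3 is covered by
     [ent p5 p3 <= 0]. *)
  apply: (@row_absurd p5 p2 (p2.1 - p5.1) (a p3.2 - a p2.2)
           ((p2.1 - p5.1) * (a p5.2 - a p3.2))) => //.
  - apply: comb_below_ge; rewrite // ?[mdet p5 _]mdet_sym //; olra.
  - apply: comb_below_le; rewrite // ?[mdet p5 _]mdet_sym ?(ltW m25) ?(ltW x2) //.
    by olra.
  - apply: comb_below_mid; rewrite // ?[mdet p5 _]mdet_sym ?(ltW x2) //.
    by olra.
  - apply: comb_below_le; rewrite // ?[mdet p5 _]mdet_sym ?(ltW m45) ?(ltW x2) //.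
    by olra.
  - by rewrite comb_refl.
  - apply: comb_below_lt; rewrite // ?[mdet p5 _]mdet_sym ?(ltW m25) ?(ltW x2) //.
      by olra.
    by olra.
have u14 : p1.1 < p4.1.
  rewrite ltNge; apply/negP => u41; apply: (@bottom_row_absurd p4) => //.
  - rewrite leNgt; apply/negP => /h31m m13.
    by have := sqr_lt_nested (lexx _) v13 v34 m13 m14; onra.
  - exact: ltW.
  - by apply: (@ent_between_dec p1 p4 p5) => //; apply: ltW.
rewrite (ltr0_norm (_ : p1.1 - p4.1 < 0)) ?subr_lt0 // in anc2.
have a23 := a_sub_ge0 v23; have x1 : 0 < p4.1 - p1.1 by rewrite subr_gt0.
have [x3 x5] : 0 < p4.1 - p3.1 /\ 0 < p4.1 - p5.1 by rewrite !subr_gt0.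
have y1 := mulr_ge0 (ltW A2) (ltW x1); have y5 := mulr_gt0 A2 x5.
have y6 := mulr_ge0 (ltW A2) (ltW x3); clear m1334 h31m h21.
have [u42|u24] := le_or_lt p4.1 p2.1.
  rewrite ger0_norm ?subr_ge0 // in anc2.
  have x2 : 0 <= p2.1 - p4.1 by rewrite subr_ge0.
  have y2 := mulr_ge0 x2 a23; have y4 := mulr_ge0 x2 (ltW A2).
  (* The slope is the limiting one for p2, now to the right of p4, and c = l (a_4 - a_2) puts p3
     below the line because a_2 <= a_3. *)
  apply: (@row_absurd p4 p5 (p2.1 - p4.1) (- (a p4.2 - a p2.2))
           ((p2.1 - p4.1) * (a p4.2 - a p2.2))) => //.
  - by apply: comb_below_le; rewrite // ?[mdet p4 _]mdet_sym ?(ltW m14) //; olra.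
  - by apply: comb_below_ge; rewrite // ?[mdet p4 _]mdet_sym //; olra.
  - by apply: comb_below_le; rewrite // ?[mdet p4 _]mdet_sym ?(ltW m34) //; olra.
  - by rewrite comb_refl.
  - by apply: comb_above; rewrite // ?(ltW m45) ?(ltW h45) //; olra.
  - by apply: comb_above_lt; rewrite // ?(ltW m45) //; olra.
have h42 : 0 < ent p4 p2.
  have h43 : ent p4 p3 < 0 by apply: ent_lt0; rewrite // mdet_sym.
  rewrite ltNge; apply/negP => h42; apply: (@row_absurd p4 p5 0 (-1) 0) => //.
  - by rewrite comb_uE; nra.
  - by rewrite comb_uE; nra.
  - by rewrite comb_uE; nra.
  - by rewrite comb_refl.
  - by rewrite comb_uE; nra.
  - by rewrite comb_uE; nra.
have u32 : p3.1 < p2.1.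
  rewrite ltNge; apply/negP => u23; suff : ent p4 p2 <= 0 by lra.
  by apply: (@ent_between_inc p2 p3 p4) => //; apply: ltW.
rewrite ltr0_norm ?subr_lt0 // in anc2.
have [x2 x23] : 0 < p4.1 - p2.1 /\ 0 < p2.1 - p3.1 by rewrite !subr_gt0.
have y2 := mulr_ge0 (ltW x2) a23; have y4 := mulr_ge0 (ltW x2) (ltW A2).
have y3 := mulr_ge0 (ltW A2) (ltW x23).
apply: (@row_absurd p4 p5 (p4.1 - p2.1) (- (a p4.2 - a p2.2)) 0) => //.
- by apply: comb_below_le; rewrite // ?[mdet p4 _]mdet_sym ?(ltW m14) //; olra.
- by apply: comb_below_ge; rewrite // ?[mdet p4 _]mdet_sym //; olra.
- by apply: comb_below_le; rewrite // ?[mdet p4 _]mdet_sym ?(ltW m34) //; olra.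
- by rewrite comb_refl.
- by apply: comb_above; rewrite // ?(ltW m45) ?(ltW h45) //; olra.
- by apply: comb_above_lt; rewrite // ?(ltW m45) //; olra.
Qed.

(** The maximal points are p4 and p5, and row p5 is used, with p1 and p4 to its right in u. If p3 is
    below p5, the line comes from [separating_line]; otherwise p2 alone fixes the slope. *)
Lemma absurd_14_25_34 : 0 <= mdet p1 p4 -> 0 <= mdet p2 p5 -> 0 <= mdet p3 p4 ->
  mdet p1 p2 < 0 ->
  mdet p1 p5 < 0 -> mdet p2 p3 < 0 -> mdet p2 p4 < 0 -> mdet p4 p5 < 0 ->
  mdet p1 p3 < 0 \/ mdet p3 p5 < 0 -> p5.1 < p4.1 -> False.
Proof.
move=> m14 m25 m34 m12 m15 m23 m24 m45 m1335 u54.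
have /and5P[_ _ n14 _ /and5P[_ _ n25 n34 _]] := neqs.
have v14' : p1.2 < p4.2 by apply: mdet_ge0_lt; rewrite // mdet_sym.
have v15' : p1.2 < p5.2 by apply: lt_le_trans v45.
have v25' : p2.2 < p5.2 by apply: mdet_ge0_lt; rewrite // mdet_sym.
have v34' : p3.2 < p4.2 by apply: mdet_ge0_lt; rewrite // mdet_sym.
have h51 : ent p5 p1 < 0 by apply: ent_lt0; rewrite // mdet_sym.
have h54 : ent p5 p4 < 0 by apply: ent_lt0; rewrite // mdet_sym.
have u51 : p5.1 < p1.1.
  rewrite ltNge; apply/negP => u15.
  by have := sqr_lt_nested (lexx _) v14 v45 m14 m15; onra.
have A2 : 0 < a p5.2 - a p2.2 by apply: a_sub_gt0.
have x1 : 0 < p1.1 - p5.1 by rewrite subr_gt0.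
have x4 : 0 < p4.1 - p5.1 by rewrite subr_gt0.
have anc2 := cone_slope v12 v25; rewrite ![mdet p5 _]mdet_sym in anc2.
have {}anc2 := anc2 m25 (ltW m15); rewrite (gtr0_norm x1) in anc2.
have a23 := a_sub_ge0 v23; have a34 := a_sub_gt0 v34'; have a45 := a_sub_ge0 v45.
have g24 : 0 < p2.1 - p5.1 -> 0 < ent p5 p2 -> p2.1 - p5.1 < p4.1 - p5.1.
  move=> x2 h52; rewrite ltrD2r ltNge; apply/negP => u42.
  suff : ent p5 p2 <= 0 by rewrite leNgt h52.
  by apply: (@ent_between_dec p2 p4 p5) => //; apply: ltW.
have row5 l k c : 0 <= l -> 0 < k -> 0 <= c ->
    l * (a p5.2 - a p1.2) <= k * (p1.1 - p5.1) + c ->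
    l * (a p5.2 - a p4.2) <= k * (p4.1 - p5.1) + c ->
    0 <= comb l k c p5 p2 -> 0 <= comb l k c p5 p3 -> False.
  move=> l0 k0 c0 n1 n4 sp2 sp3.
  have kx1 := mulr_gt0 k0 x1; have kx4 := mulr_gt0 k0 x4.
  apply: (@row_absurd p5 p1 l k c) => //.
  - by apply: comb_below_le; rewrite // ?[mdet p5 _]mdet_sym ?(ltW m15) ?(ltW kx1).
  - by apply: comb_below_le; rewrite // ?[mdet p5 _]mdet_sym ?(ltW m45) ?(ltW kx4).
  - by rewrite comb_refl.
  - apply: comb_below_lt; rewrite // ?[mdet p5 _]mdet_sym ?(ltW m15) ?(ltW kx1) //.
    by apply: ltr_wpDl => //; apply: mulr_ge0 => //; apply: a_sub_ge0.
have [m35|m35] := le_or_lt 0 (mdet p3 p5); last first.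
  have h53 : ent p5 p3 < 0 by apply: ent_lt0; rewrite // mdet_sym.
  have u53 : p5.1 < p3.1.
    rewrite ltNge; apply/negP => u35.
    by have := sqr_lt_nested (lexx _) v34 v45 m34 m35; onra.
  have x3 : 0 < p3.1 - p5.1 by rewrite subr_gt0.
  have sp3 l k c : 0 <= l -> 0 < k ->
      l * (a p5.2 - a p3.2) <= k * (p3.1 - p5.1) + c -> 0 <= comb l k c p5 p3.
    move=> l0 k0 n3; have kx3 := mulr_gt0 k0 x3.
    by apply: comb_below_le; rewrite // ?[mdet p5 _]mdet_sym ?(ltW m35) ?(ltW kx3).
  have kx1 := mulr_gt0 A2 x1; have kx3 := mulr_gt0 A2 x3.
  have kx4 := mulr_gt0 A2 x4.
  have [x2|x2] := le_or_lt (p2.1 - p5.1) 0.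
    have l0 : 0 <= - (p2.1 - p5.1) by rewrite oppr_ge0.
    rewrite (ler0_norm x2) in anc2.
    have y1 := mulr_ge0 l0 (ltW A2); have y2 := mulr_ge0 l0 a23.
    have y3 := mulr_ge0 l0 (ltW a34).
    apply: (row5 (- (p2.1 - p5.1)) (a p5.2 - a p2.2)
              (- (p2.1 - p5.1) * (a p5.2 - a p2.2))) => //; [olra | olra | |].
      by apply: comb_below_ge; rewrite // ?[mdet p5 _]mdet_sym //; olra.
    by apply: sp3 => //; olra.
  have h52 : 0 < ent p5 p2.
    rewrite ltNge; apply/negP => h52; apply: (@row_absurd p5 p4 0 1 0) => //;
      rewrite ?comb_refl // comb_uE mul1r.
    - by rewrite mulr_le0 ?oppr_le0 ?(ltW x1) ?(ltW h51).
    - by rewrite mulr_le0 ?oppr_le0 ?(ltW x2).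
    - by rewrite mulr_le0 ?oppr_le0 ?(ltW x3) ?(ltW h53).
    - by rewrite mulr_le0 ?oppr_le0 ?(ltW x4) ?(ltW h54).
    - by rewrite nmulr_rgt0 ?oppr_lt0.
  have x24 := g24 x2 h52; have x23 : p2.1 - p5.1 < p3.1 - p5.1.
    rewrite ltrD2r ltNge; apply/negP => u32.
    suff : ent p5 p2 <= 0 by rewrite leNgt h52.
    by apply: (@ent_between_dec p2 p3 p5) => //; apply: ltW.
  rewrite (gtr0_norm x2) in anc2.
  have y1 := mulr_ge0 (ltW x2) (ltW A2); have y2 := mulr_ge0 (ltW x2) a23.
  have y3 := mulr_ge0 (ltW x2) (ltW a34).
  have [x42 x32] : 0 < p4.1 - p2.1 /\ 0 < p3.1 - p2.1.
    by split; rewrite subr_gt0; [move: x24 | move: x23]; rewrite ltrD2r.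
  have y4 := mulr_ge0 (ltW A2) (ltW x42); have y5 := mulr_ge0 (ltW A2) (ltW x32).
  apply: (row5 (p2.1 - p5.1) (a p5.2 - a p2.2) 0) => //;
    [exact: ltW | olra | olra | |].
    by apply: comb_below_ge; rewrite // ?[mdet p5 _]mdet_sym //; olra.
  by apply: sp3 => //; olra.
have m13 : mdet p1 p3 < 0 by case: m1335 => //; rewrite ltNge m35.
have anc3 := cone_slope v13 v35; rewrite ![mdet p5 _]mdet_sym in anc3.
have {}anc3 := anc3 m35 (ltW m15); rewrite (gtr0_norm x1) in anc3.
have [||||l [k [c [[l0 k0 c0] n1 n4 ok2 ok3]]]] := @separating_line
  (p1.1 - p5.1) (p2.1 - p5.1) (p3.1 - p5.1) (p4.1 - p5.1)
  (a p5.2 - a p1.2) (a p5.2 - a p2.2) (a p5.2 - a p3.2) (a p5.2 - a p4.2)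
  (ent p5 p2) (ent p5 p3) x1 x4 a45 _ _ anc2 anc3 g24.
- by olra.
- by olra.
- move=> x3 x43; have := cone_slope_step v13 v34 (ltW m13) m34.
  have u31 : p3.1 < p1.1.
    rewrite ltNge; apply/negP => u13.
    by have := sqr_lt_nested v13 v35 (lexx _) m35 m15; onra.
  rewrite (@ltr0_norm _ (p4.1 - p3.1)) ?(@ltr0_norm _ (p3.1 - p1.1)); olra.
- move=> x2 h52 x3 h53; apply: (@row_absurd p5 p4 0 1 0) => //;
      rewrite ?comb_refl // comb_uE mul1r.
  + by rewrite mulr_le0 ?oppr_le0 ?(ltW x1) ?(ltW h51).
  + by rewrite mulr_le0 ?oppr_le0 ?(ltW x2).
  + by rewrite mulr_le0 ?oppr_le0 ?(ltW x3).
  + by rewrite mulr_le0 ?oppr_le0 ?(ltW x4) ?(ltW h54).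
  + by rewrite nmulr_rgt0 ?oppr_lt0.
apply: (row5 l k c) => //.
  case: ok2 => [[? ?]|[? ? ?]].
    by apply: comb_below_ge; rewrite // mdet_sym.
  by apply: comb_below_mid; rewrite // ?[mdet p5 _]mdet_sym ?mulr_ge0 // ltW.
case: ok3 => [[? ?]|[? ? ?]].
  by apply: comb_below_ge; rewrite // mdet_sym.
by apply: comb_below_mid; rewrite // ?[mdet p5 _]mdet_sym ?mulr_ge0 // ltW.
Qed.

End Five.

(** * Reduction of five balanced points to the three families *)

Lemma mdet_trans x y z : x.2 <= y.2 -> y.2 <= z.2 -> 0 <= mdet x y ->
  0 <= mdet y z ->
  0 <= mdet x z.
Proof.
move=> vxy vyz; rewrite /mdet => m1 m2.
have [A1 A2] := (a_sub_ge0 vxy, a_sub_ge0 vyz).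
have [l1 l2] : 0 <= y.2 - x.2 /\ 0 <= z.2 - y.2 by rewrite !subr_ge0.
set A := a y.2 - a x.2 in A1; set B := a z.2 - a y.2 in A2.
have m1' : (y.1 - x.1) ^+ 2 <= A * (y.2 - x.2) by rewrite /A; lra.
have m2' : (z.1 - y.1) ^+ 2 <= B * (z.2 - y.2) by rewrite /B; lra.
(* The arithmetic-geometric mean inequality bounds the mixed term in the determinant of a sum of two
   positive semidefinite 2x2 matrices. *)
have : 2 * ((y.1 - x.1) * (z.1 - y.1)) <= A * (z.2 - y.2) + B * (y.2 - x.2).
  apply: le_trans (ler_norm _) _.
  rewrite -(@ler_pXn2r _ 2) ?nnegrE ?addr_ge0 ?mulr_ge0 //.
  rewrite -normrX ger0_norm ?sqr_ge0 //.
  have := ler_pM (sqr_ge0 _) (sqr_ge0 _) m1' m2'.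
  have := sqr_ge0 (A * (z.2 - y.2) - B * (y.2 - x.2)).
  lra.
rewrite /A /B; lra.
Qed.

Lemma flip_uniq s : uniq s -> uniq (map flip s).
Proof.
move=> us; rewrite map_inj_uniq // => -[u v] [u' v'] [/eqP + ->].
by rewrite eqr_opp => /eqP->.
Qed.

Lemma mdet_lt0_neq p q : mdet p q < 0 -> p.1 < q.1 \/ q.1 < p.1.
Proof.
move=> mn; case: (ltgtP p.1 q.1) => [| |e]; [by left | by right |].
move: mn; rewrite ltNge /mdet e subrr expr0n subr0.
case/orP: (le_total p.2 q.2) => v; have := a_le v; rewrite -subr_le0 => A.
  by rewrite mulr_le0 // subr_le0.
by rewrite -mulrNN mulr_le0 // ?opprB // subr_le0.
Qed.

Lemma five_absurd p1 p2 p3 p4 p5 :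
  uniq [:: p1; p2; p3; p4; p5] -> balanced [:: p1; p2; p3; p4; p5] ->
  p1.2 <= p2.2 -> p2.2 <= p3.2 -> p3.2 <= p4.2 -> p4.2 <= p5.2 -> False.
Proof.
set s := [:: p1; p2; p3; p4; p5] => us bs v12 v23 v34 v45.
have usf := flip_uniq us; have bsf := balanced_flip bs.
pose p i := nth p1 s i; pose B i j := 0 <= mdet (p i) (p j).
have v_le i j : (i <= j)%N -> (j < 5)%N -> (p i).2 <= (p j).2.
  elim: j => [|j IH]; first by rewrite leqn0 => /eqP->.
  rewrite leq_eqVlt => /orP[/eqP->//|]; rewrite ltnS => ij j5.
  apply: le_trans (IH ij (ltnW j5)) _.
  by case: j j5 {IH ij} => [|[|[|[|//]]]].
have compB : compatible B.
  apply/andP; split; last first.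
    apply/allP => i _; apply/allP => j _; apply/allP => k.
    rewrite mem_iota => /andP[_ k5]; apply/implyP => /and4P[ij jk Bij Bjk].
    apply: mdet_trans Bij Bjk; apply: v_le => //; first exact: ltnW.
      exact: ltn_trans jk k5.
    exact: ltnW.
  apply/allP => i; rewrite mem_iota => /andP[_ i5].
  apply/allP => t; rewrite mem_iota => /andP[_ t5].
  apply/negP => /allP H; apply: (@threshold_absurd s (p i) (a (p t).2)) => //.
    exact: mem_nth.
  move=> q /(nthP p1)[j j5 <-] jNi.
  have := H j; rewrite mem_iota => /(_ j5) /orP[/eqP e|].
    by move: jNi; rewrite e eqxx.
  rewrite /B; case: ifP => [le jt|nle tj]; split.
  - by move=> _; apply/a_le/v_le.
  - by rewrite ltNge le.
  - by [].
  - by move=> _; apply/a_le/v_le.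
have BC i j : B i j = B j i by rewrite /B mdet_sym.
have := compatible_cases BC compB; rewrite /B /p /= -!ltNge.
case/or3P => [/and5P[m15 m35 m24 m12]|/and5P[m23 m45 m15 m12]|/and5P[m14 m25 m34 m12]].
- case/and5P=> [m14 m23 m25 m45 /orP mm].
  by case: (mdet_lt0_neq m45) => u; [
    apply: (absurd_15_35_24 usf bsf) | apply: (absurd_15_35_24 us bs)];
    rewrite ?mdet_flip //= ltrN2.
- case/and3P=> [m13 m34 m35].
  by case: (mdet_lt0_neq m35) => u; [
    apply: (absurd_23_45_15 usf bsf) | apply: (absurd_23_45_15 us bs)];
    rewrite ?mdet_flip //= ltrN2.
- case/and5P=> [m15 m23 m24 m45 /orP mm].
  by case: (mdet_lt0_neq m45) => u; [
    apply: (absurd_14_25_34 usf bsf) | apply: (absurd_14_25_34 us bs)];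
    rewrite ?mdet_flip //= ltrN2.
Qed.

Lemma balanced_absurd s : size s = 5 -> uniq s -> balanced s -> False.
Proof.
move=> sz us bs; pose le (p q : R * R) := p.2 <= q.2.
have := sort_sorted (fun p q => le_total p.2 q.2 : le p q || le q p) s.
have ps : perm_eq s (sort le s) by rewrite perm_sym perm_sort.
have := perm_size ps; rewrite sz; have := perm_uniq ps; rewrite us.
have := balanced_perm ps bs.
case: (sort le s) => [|p1 [|p2 [|p3 [|p4 [|p5 [|? ?]]]]]] //= bs' /esym us' _.
by case/and5P=> v12 v23 v34 v45 _; apply: (five_absurd us' bs').
Qed.

End Core.

(** * Chord inequalities for a convex function and its primitive *)

Section Primitive.
Variables (R : realType) (a : R -> R).
Hypothesis a_cont : continuous a.
Local Notation mu := lebesgue_measure.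
Local Notation I x y := (\int[mu]_(t in `[x, y]) a t).

Lemma a_integrable (x y : R) : mu.-integrable `[x, y] (EFin \o a).
Proof.
apply: continuous_compact_integrable; first exact: segment_compact.
exact: continuous_subspaceT.
Qed.

Lemma integral_chasles x y z : x <= y -> y <= z -> I x z = I x y + I y z.
Proof.
move=> xy yz; apply/eqP; rewrite addrC -subr_eq; apply/eqP.
rewrite (Rintegral_itvB (a_integrable x z)) ?bnd_simp //.
rewrite Rintegral_itv_obnd_cbnd //.
apply: integrableS (a_integrable y z) => //.
by apply: subset_itvr; rewrite bnd_simp.
Qed.

Lemma oriented_integral_sub x y : x <= y ->
  oriented_integral a 0 y - oriented_integral a 0 x = I x y.
Proof.
move=> xy; rewrite /oriented_integral; case: (leP 0 x) => x0.
  by rewrite (le_trans x0 xy) (integral_chasles x0 xy); ring.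
case: (leP 0 y) => y0; first by rewrite (integral_chasles (ltW x0) y0); ring.
by rewrite (integral_chasles xy (ltW y0)); ring.
Qed.

(** The mean value theorem for the primitive minus a quadratic, so that [a] is compared at one point
    with the affine function al + 2 be t. *)
Lemma primitive_MVT (al be x y : R) : x < y -> exists2 z, x < z < y &
  oriented_integral a 0 y - oriented_integral a 0 x
    - (al * (y - x) + be * (y ^+ 2 - x ^+ 2)) = (a z - (al + 2 * be * z)) * (y - x).
Proof.
move=> xy; pose c := x - 1; pose G t := I c t.
have cx : c < x by rewrite /c; lra.
have dG t : c < t -> is_derive t 1 G (a t).
  move=> ct; have [||||d1 d2] := @continuous_FTC1 R a (BLeft c) t (t + 1).
  - by rewrite ltrDl.
  - exact: a_integrable.
  - by [].
  - exact: a_cont.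
  by apply: DeriveDef => //; rewrite -derive1E.
pose g := G - (al *: (@id R) + be *: ((@id R) ^+ 2)).
have gE t : g t = G t - (al * t + be * t ^+ 2) by [].
have dg t : c < t -> is_derive t 1 g (a t - (al + 2 * be * t)).
  move=> /dG ?; rewrite /g; apply: is_derive_eq.
  by rewrite /GRing.scale /= !mulr1; ring.
have [||z zxy e] := @MVT R g (fun t => a t - (al + 2 * be * t)) x y xy.
- by move=> t; rewrite in_itv => /andP[xt _]; apply: dg; apply: lt_trans xt.
- apply: derivable_within_continuous => t; rewrite in_itv => /andP[xt _].
  by have [] := dg t (lt_le_trans cx xt).
exists z; first by move: zxy; rewrite in_itv.
rewrite -e !gE oriented_integral_sub ?(ltW xy) //.
by rewrite /G (@integral_chasles c x y) ?ltW //; ring.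
Qed.

End Primitive.

Section ConvexPrimitive.
Variables (R : realType) (a : R -> R).
Hypothesis aC1 : C1 a.
Hypothesis a_convex : strictly_convex a.
Hypothesis a_incr : strictly_increasing a.
Local Notation F := (oriented_integral a 0).

Lemma C1_continuous : continuous a.
Proof.
by case: aC1 => d _ x; apply/differentiable_continuous/derivable1_diffP/d.
Qed.

Lemma chord_lt x y z : x < y -> y < z ->
  (a y - a x) * (z - y) < (a z - a y) * (y - x).
Proof.
move=> xy yz; have zx : 0 < z - x by lra.
have := @a_convex x z ((z - y) / (z - x)).
have -> : (z - y) / (z - x) * x + (1 - (z - y) / (z - x)) * z = y.
  by field; lra.
move=> /(_ _ _) H; have {}H : a y < (z - y) / (z - x) * a x
    + (1 - (z - y) / (z - x)) * a z.
  apply: H; first by apply/eqP; lra.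
  apply/andP; split; first by apply: divr_gt0; lra.
  by rewrite ltr_pdivrMr // mul1r; lra.
have : a y * (z - x) < (z - y) * a x + (y - x) * a z.
  have -> : (z - y) * a x + (y - x) * a z
     = ((z - y) / (z - x) * a x + (1 - (z - y) / (z - x)) * a z) * (z - x).
    by field; lra.
  by rewrite ltr_pM2r.
lra.
Qed.

Lemma chord_le x y z : x <= y -> y <= z ->
  (a y - a x) * (z - y) <= (a z - a y) * (y - x).
Proof.
rewrite le_eqVlt => /orP[/eqP->|xy]; first by rewrite !subrr mul0r mulr0.
rewrite le_eqVlt => /orP[/eqP->|yz]; first by rewrite !subrr mul0r mulr0.
exact/ltW/chord_lt.
Qed.

Lemma primitive_trapezoid x y : x < y -> 2 * (F y - F x) < (a x + a y) * (y - x).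
Proof.
move=> xy; pose s := (a y - a x) / (y - x).
have sE : s * (y - x) = a y - a x by rewrite /s; field; lra.
(* With these coefficients al + 2 be t is the chord of [a] over [x, y]. *)
have [z /andP[xz zy]] := primitive_MVT C1_continuous (a x - s * x) (s / 2) xy.
have := chord_lt xz zy => c e.
have lt : (a z - (a x - s * x + 2 * (s / 2) * z)) * (y - x) < 0.
  have -> : (a z - (a x - s * x + 2 * (s / 2) * z)) * (y - x)
    = (a z - a x) * (y - x) - s * (y - x) * (z - x) by field.
  by rewrite sE; lra.
have : s * (y - x) * (y - x) = (a y - a x) * (y - x) by rewrite sE.
lra.
Qed.

Lemma primitive_above x y : x <= y -> a x * (y - x) <= F y - F x.
Proof.
rewrite le_eqVlt => /orP[/eqP->|xy]; first by rewrite !subrr mulr0.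
have [z /andP[xz zy]] := primitive_MVT C1_continuous (a x) 0 xy.
have : 0 <= (a z - a x) * (y - x).
  by rewrite mulr_ge0 ?subr_ge0 ?(ltW xy) // ltW // a_incr.
lra.
Qed.

(** Beyond y, [a] lies above the extension of its chord over [x, y]. The next lemma uses in the same
    way the chord over [y, z], extended to the left of y. *)
Lemma primitive_right x y z : x < y -> y <= z ->
  (a y - a x) * (z - y) ^+ 2 <= 2 * (F z - F y - a y * (z - y)) * (y - x).
Proof.
move=> xy; rewrite le_eqVlt => /orP[/eqP->|yz]; first by rewrite !subrr; lra.
pose s := (a y - a x) / (y - x).
have sE : s * (y - x) = a y - a x by rewrite /s; field; lra.
have [t /andP[yt tz] e] := primitive_MVT C1_continuous (a y - s * y) (s / 2) yz.
have c := chord_lt xy yt.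
have ge : 0 <= (a t - (a y - s * y + 2 * (s / 2) * t)) * (z - y) * (y - x).
  have -> : (a t - (a y - s * y + 2 * (s / 2) * t)) * (z - y) * (y - x)
    = ((a t - a y) * (y - x) - s * (y - x) * (t - y)) * (z - y) by field.
  by rewrite sE mulr_ge0 //; lra.
rewrite -sE; rewrite -e in ge; lra.
Qed.

Lemma primitive_left x y z : x <= y -> y < z ->
  2 * (a y * (y - x) - (F y - F x)) * (z - y) <= (a z - a y) * (y - x) ^+ 2.
Proof.
rewrite le_eqVlt => /orP[/eqP->|xy] yz; first by rewrite !subrr; lra.
pose s := (a z - a y) / (z - y).
have sE : s * (z - y) = a z - a y by rewrite /s; field; lra.
have [t /andP[xt ty] e] := primitive_MVT C1_continuous (a y - s * y) (s / 2) xy.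
have c := chord_lt ty yz.
have ge : 0 <= (a t - (a y - s * y + 2 * (s / 2) * t)) * (y - x) * (z - y).
  have -> : (a t - (a y - s * y + 2 * (s / 2) * t)) * (y - x) * (z - y)
    = (s * (z - y) * (y - t) - (a y - a t) * (z - y)) * (y - x) by field.
  by rewrite sE mulr_ge0 //; lra.
rewrite -sE; rewrite -e in ge; lra.
Qed.

End ConvexPrimitive.

(** * Minors along a T_N configuration *)

Lemma rank1_minor (K : fieldType) (m n : nat) (A : 'M[K]_(m, n)) i i' j j' :
  (\rank A <= 1)%N -> A i j * A i' j' = A i j' * A i' j.
Proof.
have AE x y : A x y = \sum_t col_base A x t * row_base A t y.
  by rewrite -{1}(mulmx_base A) mxE.
rewrite !{}AE; move: (col_base A) (row_base A).
case: (\rank A) => [|[|r]] B C // _; first by rewrite !big_ord0 !mul0r.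
by rewrite !big_ord1; ring.
Qed.

Definition minors (K : fieldType) (b c d : K) (Z : 'M[K]_(3, 2)) : K :=
  b * (Z 0 0 * Z 1 1 - Z 0 1 * Z 1 0)
  + c * (Z 0 0 * Z 2 1 - Z 0 1 * Z 2 0)
  + d * (Z 1 0 * Z 2 1 - Z 1 1 * Z 2 0).

Lemma minors_rank1 (K : fieldType) (b c d t : K) (D : 'M[K]_(3, 2)) :
  (\rank D <= 1)%N -> minors b c d (t *: D) = 0.
Proof.
move=> rD; transitivity (t ^+ 2 * minors b c d D).
  by rewrite /minors !mxE; ring.
by rewrite /minors !(rank1_minor _ _ 0 1 rD) !subrr !mulr0 !addr0 mulr0.
Qed.

(** Along the line W - t D the minors are quadratic in t with leading coefficient the minor of D,
    which is zero; hence they are affine, and t = 1 is interpolated between 0 and k. *)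
Lemma minors_rank1_line (K : fieldType) (b c d k : K) (W D : 'M[K]_(3, 2)) :
  (\rank D <= 1)%N -> k != 0 ->
  minors b c d (W - D)
  = (1 - k^-1) * minors b c d W + k^-1 * minors b c d (W - k *: D).
Proof.
move=> rD k0.
have lineE t : minors b c d (W - t *: D) = minors b c d W
   + t * (minors b c d (W - D) - minors b c d W).
  apply/eqP; rewrite -subr_eq0; apply/eqP.
  transitivity (t * (t - 1) * minors b c d (1 *: D)).
    by rewrite /minors !mxE; ring.
  by rewrite minors_rank1 // mulr0.
by rewrite lineE; field.
Qed.

Lemma iter_ordS (N : nat) (i : 'I_N) (n : nat) :
  val (iter n (@ordS N) i) = ((i + n) %% N)%N.
Proof.
elim: n => [|n IH]; first by rewrite addn0 modn_small.
by rewrite iterS /= IH -addn1 modnDml addn1 addnS.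
Qed.

(* Going once around the cycle P_i, P_(i+1), ..., P_i through the segments
   [P_j, X_j] expresses the value 0 at P_i as a combination of the values at
   the X_j with positive weights. *)
Lemma TN_weights (R : realType) (N : nat) (X : 'I_N -> 'M[R]_(3, 2)) (i : 'I_N) :
  induces_TN X -> exists w : 'I_N -> R, (forall j, 0 < w j) /\
    forall b c d, \sum_j w j * minors b c d (X i - X j) = 0.
Proof.
case=> _ [Q [D [k [k1 rD D0 XE]]]].
pose P (j : 'I_N) := Q + \sum_(l < N | (l < j)%N) D l.
(* At the last index the path returns to P_0 = Q because the D_j sum to zero. *)
have PS j : P (ordS j) = P j + D j.
  have E : \sum_(l < N | (l < j)%N) D l + D j = \sum_(l < N | (l < j.+1)%N) D l.
    rewrite [RHS](bigD1 j) ?ltnSn //= addrC; congr (_ + _).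
    by apply: eq_bigl => l; rewrite ltnS [RHS]andbC -ltn_neqAle.
  rewrite /P -addrA E /=; have [lt|] := ltnP j.+1 N; first by rewrite modn_small.
  rewrite leq_eqVlt ltnNge ltn_ord orbF => /eqP e; rewrite -e modnn.
  rewrite big_pred0 //; congr (_ + _); rewrite -[LHS]D0.
  by apply: eq_bigl => l; rewrite -?e ltn_ord.
have XP j : X j = P j + k j *: D j by rewrite XE.
have k0 j : k j != 0 by rewrite gt_eqF // (lt_trans _ (k1 j)).
have kV j : 0 < (k j)^-1 < 1.
  by rewrite invr_gt0 (lt_trans _ (k1 j)) //= invf_lt1 // (lt_trans _ (k1 j)).
have step n : exists w : 'I_N -> R, [/\ forall j, 0 <= w j,
    forall l, (l < n)%N -> 0 < w (iter l (@ordS N) i) &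
    forall b c d, minors b c d (X i - P (iter n (@ordS N) i))
      = \sum_j w j * minors b c d (X i - X j)].
  elim: n => [|n [w [w0 wp wE]]].
    exists (fun=> 0); split=> // b c d.
    rewrite big1 => [|j _]; last by rewrite mul0r.
    by rewrite /= XP addrC addKr minors_rank1.
  set j0 := iter n (@ordS N) i in wE *.
  have /andP[t0 t1] := kV j0.
  (* The next vertex P_(j0) + D_(j0) divides the segment from P_(j0) to X_(j0) in the ratio 1 /
     k_(j0). *)
  exists (fun j => (1 - (k j0)^-1) * w j + (k j0)^-1 * (j == j0)%:R).
  split=> [j|l|b c d].
  - by apply: addr_ge0; apply: mulr_ge0; rewrite // ?subr_ge0 ?ltW // ler0n.
  - rewrite ltnS leq_eqVlt => /orP[/eqP->|ln].
      rewrite -/j0 eqxx mulr1; apply: ltr_wpDl => //.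
      by apply: mulr_ge0; rewrite // subr_ge0 ltW.
    apply: ltr_pwDl; first by apply: mulr_gt0; rewrite ?subr_gt0 // wp.
    by apply: mulr_ge0; rewrite ?ler0n // ltW.
  - under eq_bigr do rewrite mulrDl -!mulrA.
    rewrite big_split /= -mulr_sumr -wE (bigD1 j0) //= [X in _ + (_ + X)]big1.
      rewrite eqxx mul1r addr0 -/j0 PS (opprD (P j0)) addrA.
      rewrite (minors_rank1_line _ _ _ _ (rD j0) (k0 j0)).
      by rewrite [in RHS](XP j0) (opprD (P j0)) addrA.
    by move=> j /negPf->; rewrite mul0r mulr0.
(* After N steps every index has been visited, which makes all weights positive, and the path is
   back at P_i, where X_i - P_i = k_i D_i has zero minors. *)
have [w [_ wp wE]] := step N; exists w; split=> [j|b c d].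
  have -> : j = iter ((j + N - i) %% N)%N (@ordS N) i.
    apply/val_inj; rewrite iter_ordS modnDmr subnKC.
      by rewrite modnDr modn_small.
    by rewrite (leq_trans (ltnW (ltn_ord i))) // leq_addl.
  by apply: wp; rewrite ltn_mod (leq_ltn_trans _ (ltn_ord i)).
rewrite -wE; have -> : iter N (@ordS N) i = i.
  by apply/val_inj; rewrite iter_ordS modnDr modn_small.
by rewrite XP addrC addKr minors_rank1.
Qed.

(** The coefficients of the minors depend on p and not on q, so the weights of row p apply to every
    [comb] in that row. *)
Lemma comb_minors (R : realType) (a : R -> R) (l k c : R) (p q : R * R) :
  comb a (oriented_integral a 0) l k c p q
  = minors (2 * l * a p.2 + 2 * k * p.1 - c) (- (2 * l)) (2 * k)
      (Ka_mx a p.1 p.2 - Ka_mx a q.1 q.2).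
Proof. by rewrite /minors /comb /ent /mdet !mxE /=; field. Qed.

Theorem theorem1p2 (R : realType) (a : R -> R)
    (aC1 : C1 a)
    (a_convex : strictly_convex a)
    (a_incr : strictly_increasing a)
    (a0 : a 0 = 0) :
  ~ exists X : 'I_5 -> 'M[R]_(3, 2),
      (forall i, Ka a (X i)) /\ induces_TN X.
Proof.
case=> X [KX TX].
have /choice[p pE] : forall i, exists p : R * R, X i = Ka_mx a p.1 p.2.
  by move=> i; have [u [v ->]] := KX i; exists (u, v).
have p_inj : injective p by move=> i j e; apply: TX.1; rewrite !pE e.
apply: (@balanced_absurd R a (oriented_integral a 0) a_incr
  (chord_le a_convex) (primitive_trapezoid aC1 a_convex)
  (primitive_above aC1 a_incr) (primitive_right aC1 a_convex)
  (primitive_left aC1 a_convex) (codom p)).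
- by rewrite size_codom card_ord.
- by rewrite map_inj_uniq // enum_uniq.
move=> _ /codomP[i ->] l k c comb0 _ /codomP[j ->].
have [w [w0 wE]] := TN_weights i TX.
have wS n : 0 <= w n * comb a (oriented_integral a 0) l k c (p i) (p n).
  by apply: mulr_ge0 (ltW (w0 n)) _; apply: comb0; apply: codom_f.
have : \sum_n w n * comb a (oriented_integral a 0) l k c (p i) (p n) = 0.
  by under eq_bigr do rewrite comb_minors -!pE; apply: wE.
move/eqP; rewrite psumr_eq0 // => /allP/(_ j); rewrite mem_index_enum.
by move=> /(_ isT) /=; rewrite mulf_eq0 gt_eqF //= => /eqP.
Qed.
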